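(* Let $g:\mathbb{R}^n\to\mathbb{R}$ be defined by $g(z)=\alpha L_\mu(a^\top z+b)$ with $a\in\mathbb{R}^n$, $b\in\mathbb{R}$, $\alpha\in\mathbb{R}_+$ and $L_\mu:\mathbb{R}\to\mathbb{R}_+$ defined, for a given $\mu>0$, by $$L_\mu(e)=|e|-\frac1\mu\ln(1+\mu|e|).$$ Then for all $x\in\mathbb{R}^n$, $$\mathrm{prox}_g(x)=x-\frac{\alpha\mu\omega}{1+s^\star\mu\omega}\,a,$$ with $s^\star=\mathrm{sign}(a^\top x+b)\in\{-1,0,+1\}$ and $$\omega=\frac{r+s^\star\sqrt{\Delta}}{2\mu},\qquad r=\mu(a^\top x+b)-s^\star\big(1+\alpha\mu\|a\|_2^2\big),\qquad \Delta=r^2+4\mu|a^\top x+b|.$$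
   Context: The proximal operator of $f:\mathbb{R}^n\to\mathbb{R}$ is $\mathrm{prox}_f(x)=\operatorname*{arg\,min}_{z\in\mathbb{R}^n}\big[\tfrac12\|z-x\|_2^2+f(z)\big]$. The convention $\mathrm{sign}(0)=0$ is used. $\mathbb{R}_+$ denotes the nonnegative reals. *)

(* Defs.v *)
From HB Require Import structures.
From mathcomp Require Import all_boot all_order all_algebra.
From mathcomp Require Import all_classical all_reals all_analysis.

Set Implicit Arguments.
Unset Strict Implicit.
Unset Printing Implicit Defensive.

Import Order.TTheory GRing.Theory Num.Theory.

Local Open Scope classical_set_scope.
Local Open Scope ring_scope.

(* The library norm `|v| on matrices is the sup norm, hence this definition. *)
Definition norm2 (R : realType) (n : nat) (v : 'cV[R]_n) : R :=
  Num.sqrt (\sum_(i < n) v i 0 ^+ 2).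

Definition argmin (R : realType) (T : Type) (F : T -> R) : set T :=
  [set z | forall w, F z <= F w].

(* Set-valued: "prox f x is the point p" reads [prox f x = [set p]], which
   asserts both that p is a minimizer and that it is the only one. *)
Definition prox (R : realType) (n : nat) (f : 'cV[R]_n -> R) (x : 'cV[R]_n) :
    set 'cV[R]_n :=
  argmin (fun z : 'cV[R]_n => 1 / 2 * norm2 (z - x) ^+ 2 + f z).

Definition Lmu (R : realType) (mu e : R) : R :=
  `|e| - 1 / mu * ln (1 + mu * `|e|).

Lemma Lmu_ge0 (R : realType) (mu e : R) : 0 < mu -> 0 <= Lmu mu e.
Proof.
move=> mu0; rewrite /Lmu subr_ge0 mul1r ler_pdivrMl//.
by apply: le_ln1Dx; rewrite (lt_le_trans (ltrN10 R))// mulr_ge0// ltW.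
Qed.

(* Main.v *)
Require Import Defs.
From HB Require Import structures.
From mathcomp Require Import all_boot all_order all_algebra.
From mathcomp Require Import all_classical all_reals all_analysis.
From mathcomp Require Import ring lra.

Import Order.TTheory GRing.Theory Num.Theory.

Local Open Scope classical_set_scope.
Local Open Scope ring_scope.

(** The penalty [Lmu mu] is convex and differentiable, with derivative
    [mu * w / (1 + mu * `|w|)] at [w], so the proximal point [p] is
    characterised by the optimality condition: [x - p] is a subgradient of [g]
    at [p].  Since [g] only depends on [a^T z + b], every subgradient is a
    multiple of [a], whence [p = x - c *: a] with
    [c = alpha * mu * w / (1 + mu * `|w|)], where [w = a^T p + b].  Applying
    [a^T _ + b] to [p] turns this into the scalar equation
    [e - c * |a|^2 = w], which, once [w] is known to have the sign of [e], is
    the quadratic [mu * w^2 - r * w - `|e| = 0]; [omega] is its root on the side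
    of [e].

    The sufficiency of the optimality condition, together with uniqueness, is
    [prox_subgradient]; the subgradient inequality for [Lmu] is
    [Lmu_subgradient], a consequence of [ln t <= t - 1] alone; the quadratic
    is solved in [omega_sign] and [omega_fixpoint]. *)

Lemma norm2_sqr {R : realType} {n : nat} (v : 'cV[R]_n) :
  norm2 v ^+ 2 = (v^T *m v) 0 0.
Proof.
rewrite /norm2 sqr_sqrtr; last by apply: sumr_ge0 => i _; exact: sqr_ge0.
by rewrite mxE; apply: eq_bigr => i _; rewrite mxE expr2.
Qed.

Lemma dotC {R : realType} {n : nat} (u v : 'cV[R]_n) :
  (u^T *m v) 0 0 = (v^T *m u) 0 0.
Proof. by rewrite !mxE; apply: eq_bigr => i _; rewrite !mxE mulrC. Qed.

Lemma dotBr {R : realType} {n : nat} (u v w : 'cV[R]_n) :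
  (u^T *m (v - w)) 0 0 = (u^T *m v) 0 0 - (u^T *m w) 0 0.
Proof.
by rewrite !mxE -sumrB; apply: eq_bigr => i _; rewrite !mxE mulrBr.
Qed.

Lemma dotZr {R : realType} {n : nat} (c : R) (u v : 'cV[R]_n) :
  (u^T *m (c *: v)) 0 0 = c * (u^T *m v) 0 0.
Proof. by rewrite -scalemxAr mxE. Qed.

Lemma norm2D_sqr {R : realType} {n : nat} (u v : 'cV[R]_n) :
  norm2 (u + v) ^+ 2 = norm2 u ^+ 2 + 2 * (u^T *m v) 0 0 + norm2 v ^+ 2.
Proof.
rewrite !norm2_sqr !mxE mulr_sumr -!big_split /=.
by apply: eq_bigr => i _; rewrite !mxE; ring.
Qed.

Lemma norm2_sqr_eq0 {R : realType} {n : nat} (v : 'cV[R]_n) :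
  norm2 v ^+ 2 <= 0 -> v = 0.
Proof.
rewrite /norm2 sqr_sqrtr; last by apply: sumr_ge0 => i _; exact: sqr_ge0.
move=> sum_le0; have /eqP : \sum_(i < n) v i 0 ^+ 2 = 0.
  by apply/eqP; rewrite eq_le sum_le0 sumr_ge0// => i _; exact: sqr_ge0.
rewrite psumr_eq0 => [/allP sum0|i _]; last exact: sqr_ge0.
apply/matrixP => i j; rewrite (ord1 j) mxE; apply/eqP.
by rewrite -sqrf_eq0; apply: sum0; rewrite mem_index_enum.
Qed.

(** Expanding the square of [z - x = (z - p) + (p - x)], the cross term is
    absorbed by the subgradient inequality, so the objective at [z] exceeds
    its value at [p] by at least [norm2 (z - p) ^+ 2 / 2]: this strong form of
    optimality gives existence and uniqueness at once. *)
Lemma prox_subgradient {R : realType} {n : nat} (f : 'cV[R]_n -> R)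
    (x p : 'cV[R]_n) :
  (forall z, f p + ((x - p)^T *m (z - p)) 0 0 <= f z) ->
  prox f x = [set p].
Proof.
move=> subgrad.
have growth z : 1 / 2 * norm2 (p - x) ^+ 2 + f p + 1 / 2 * norm2 (z - p) ^+ 2
    <= 1 / 2 * norm2 (z - x) ^+ 2 + f z.
  have -> : z - x = (z - p) + (p - x) by rewrite addrA subrK.
  rewrite [norm2 (_ - p + _) ^+ 2]norm2D_sqr; have := subgrad z.
  rewrite (dotC (x - p)) -(opprB p x) mulmxN [(- (_ *m _)) 0 0]mxE; lra.
rewrite /prox /argmin; apply/seteqP; split => [z /= zmin|z /= -> w].
  apply/subr0_eq/norm2_sqr_eq0.
  by have := zmin p; have := growth z; lra.
by have := growth w; have := sqr_ge0 (norm2 (w - p)); lra.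
Qed.

(** Bounding [ln] of the ratio [(1 + mu * `|w|) / (1 + mu * `|v|)] by the ratio
    minus one leaves [(`|w| - `|v|) * mu * `|v| / (1 + mu * `|v|)], and
    [v * w <= `|v| * `|w|] removes the absolute values.  No case distinction
    on signs occurs, so the point [0] needs no special treatment. *)
Lemma Lmu_subgradient {R : realType} (mu v w : R) : 0 < mu ->
  Lmu mu v + mu * v / (1 + mu * `|v|) * (w - v) <= Lmu mu w.
Proof.
move=> mu0.
have dom_gt0 (t : R) : 0 < 1 + mu * `|t|.
  by rewrite ltr_pwDl// mulr_ge0// ltW.
have v0 := dom_gt0 v; have w0 := dom_gt0 w.
set q := (1 + mu * `|w|) / (1 + mu * `|v|).
have q0 : 0 < q by rewrite divr_gt0.
have lnq : ln (1 + mu * `|w|) - ln (1 + mu * `|v|) <= q - 1.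
  rewrite -ln_div ?posrE//.
  have := @le_ln1Dx R (q - 1); rewrite [1 + _]addrC subrK; apply; lra.
have lnq' : 1 / mu * (ln (1 + mu * `|w|) - ln (1 + mu * `|v|))
    <= 1 / mu * (q - 1) by rewrite ler_wpM2l// divr_ge0// ltW.
have Eq : `|w| - `|v| - 1 / mu * (q - 1) =
    mu * (`|v| * `|w| - `|v| ^+ 2) / (1 + mu * `|v|).
  by rewrite /q; field; rewrite ?gt_eqF.
have vw : v * w <= `|v| * `|w| by rewrite -normrM ler_norm.
have : mu * v / (1 + mu * `|v|) * (w - v) <=
    mu * (`|v| * `|w| - `|v| ^+ 2) / (1 + mu * `|v|).
  rewrite mulrAC ler_pM2r ?invr_gt0// -mulrA ler_pM2l// real_normK ?num_real//.
  lra.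
rewrite /Lmu; lra.
Qed.

(** The product of the roots of [mu * w^2 - r * w - `|e|] is nonpositive, that
    is [`|r| <= sqrt Delta], so adding [s * sqrt Delta] to [r] forces the sign
    [s]. *)
Lemma omega_sign {R : realType} (mu e r : R) : 0 < mu ->
  let s := Num.sg e in
  let omega := (r + s * Num.sqrt (r ^+ 2 + 4 * mu * `|e|)) / (2 * mu) in
  (e = 0 -> r = 0) -> s * omega = `|omega|.
Proof.
move=> mu0 s omega r0.
have rD : `|r| <= Num.sqrt (r ^+ 2 + 4 * mu * `|e|).
  rewrite -sqrtr_sqr ler_wsqrtr// lerDl !mulr_ge0// ltW//.
move: rD; rewrite ler_norml => /andP[rD1 rD2].
rewrite /omega normrM [`|_^-1|]gtr0_norm ?invr_gt0 ?mulr_gt0// mulrA.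
congr (_ / _); move: rD1 rD2; rewrite /s; move: (Num.sqrt _) => t rD1 rD2.
case: (sgrP e) => he.
- by rewrite r0// !mul0r addr0 normr0.
- by rewrite mul1r ger0_norm//; lra.
- by rewrite !mulN1r ler0_norm//; lra.
Qed.

(** For [e != 0], multiplying by [1 + mu * `|omega|] and using
    [`|omega| = s * omega] and [s * s = 1] turns the identity into [s] times
    the quadratic equation of which [omega] is a root.  For [e = 0] all
    quantities vanish. *)
Lemma omega_fixpoint {R : realType} (mu e k : R) : 0 < mu ->
  let s := Num.sg e in
  let r := mu * e - s * (1 + k * mu) in
  let omega := (r + s * Num.sqrt (r ^+ 2 + 4 * mu * `|e|)) / (2 * mu) in
  e - mu * omega / (1 + mu * `|omega|) * k = omega.
Proof.
move=> mu0 s r omega.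
have sE : s * omega = `|omega|.
  by apply: omega_sign => // e0; rewrite /r /s e0 sgr0 mulr0 mul0r subr0.
have den0 : 1 + mu * `|omega| != 0.
  by rewrite gt_eqF// ltr_pwDl// mulr_ge0// ltW.
have [e0|e0] := eqVneq e 0.
  have -> : omega = 0.
    by rewrite /omega /r /s e0 sgr0 mulr0 !mul0r subr0 addr0 mul0r.
  by rewrite e0 mulr0 !mul0r subr0.
have s2 : s * s = 1 by rewrite /s -expr2 sqr_sg e0.
have se : e = s * `|e| by rewrite /s -numEsg.
have quad : mu * omega ^+ 2 = r * omega + `|e|.
  have D0 : 0 <= r ^+ 2 + 4 * mu * `|e|.
    by rewrite addr_ge0 ?sqr_ge0// !mulr_ge0// ltW.
  have := sqr_sqrtr D0; set t := Num.sqrt _ => tE.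
  have Eo : omega = (r + s * t) / (2 * mu) by [].
  have mun0 : mu != 0 by rewrite gt_eqF.
  have ot : 2 * mu * omega - r = s * t.
    by rewrite Eo mulrCA mulfV ?mulr1 ?mulf_neq0// ?pnatr_eq0// addrC addKr.
  have : (2 * mu * omega - r) ^+ 2 = r ^+ 2 + 4 * mu * `|e|.
    by rewrite ot exprMn [s ^+ 2]expr2 s2 mul1r.
  (* completing the square in the quadratic equation times [4 * mu] *)
  move=> E; apply: (mulfI (_ : 4 * mu != 0)).
    by rewrite mulf_neq0// pnatr_eq0.
  lra.
apply: (mulIf den0); rewrite mulrBl mulrAC divfK// -sE.
have sr : s * r = mu * `|e| - (1 + k * mu).
  have -> : s * r = mu * (s * e) - s * s * (1 + k * mu) by rewrite /r; ring.
  by rewrite s2 mul1r [in s * e]se mulrA s2 mul1r.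
have : s * (mu * omega ^+ 2) = s * r * omega + s * `|e|.
  by rewrite quad mulrDr mulrA.
rewrite sr -se => E.
have mueo : mu * `|e| * omega = e * (mu * (s * omega)).
  rewrite [in RHS]se; transitivity (s * s * (mu * `|e| * omega)); last by ring.
  by rewrite s2 mul1r.
lra.
Qed.

Theorem lemma15 (R : realType) (n : nat) (a : 'cV[R]_n) (b alpha mu : R)
    (halpha : 0 <= alpha) (hmu : 0 < mu) :
  let g := fun z : 'cV[R]_n => alpha * Lmu mu ((a^T *m z) 0 0 + b) in
  forall x : 'cV[R]_n,
    let e := (a^T *m x) 0 0 + b in
    let s := Num.sg e in
    let r := mu * e - s * (1 + alpha * mu * norm2 a ^+ 2) in
    let Delta := r ^+ 2 + 4 * mu * `|e| in
    let omega := (r + s * Num.sqrt Delta) / (2 * mu) in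
    prox g x = [set x - (alpha * mu * omega / (1 + s * mu * omega)) *: a].
Proof.
move=> g x e s r Delta omega.
have sE : s * omega = `|omega|.
  by apply: omega_sign => // e0; rewrite /r /s e0 sgr0 mulr0 mul0r subr0.
have fix_omega : e - mu * omega / (1 + mu * `|omega|) * (alpha * norm2 a ^+ 2)
    = omega.
  by have := omega_fixpoint mu e (alpha * norm2 a ^+ 2) hmu;
    rewrite [alpha * _ * mu]mulrAC.
have -> : s * mu * omega = mu * `|omega| by rewrite -sE; ring.
have -> : alpha * mu * omega / (1 + mu * `|omega|) =
    alpha * (mu * omega / (1 + mu * `|omega|)) by rewrite !mulrA.
set d := mu * omega / _ in fix_omega *.
have ap : (a^T *m (x - (alpha * d) *: a)) 0 0 + b = omega.
  rewrite dotBr dotZr -norm2_sqr -[RHS]fix_omega /e.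
  by ring.
apply: prox_subgradient => z; rewrite /g ap.
rewrite subKr (dotC (_ *: a)) dotZr (dotC _ a).
set w := (a^T *m z) 0 0 + b.
have -> : (a^T *m (z - (x - (alpha * d) *: a))) 0 0 = w - omega.
  by rewrite dotBr -ap /w; ring.
have := ler_wpM2l halpha (Lmu_subgradient mu omega w hmu).
by rewrite -/d; lra.
Qed.
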